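(* Let $G$ be a non-periodic locally nilpotent group. Then the following conditions are equivalent: (i) $G$ is an FNI-group. (ii) $G$ is an FCI-group. (iii) $|N_G(\langle x\rangle):\langle x\rangle|<\infty$ for every $x\in G$ such that $\langle x\rangle$ is not normal in $G$.
   Context: A group is non-periodic if it has an element of infinite order, and locally nilpotent if all its finitely generated subgroups are nilpotent. A group $G$ is an FCI-group if $|C_G(x):\langle x\rangle|<\infty$ for every $x\in G$ such that $\langle x\rangle$ is not normal in $G$. A group $G$ is an FNI-group if $|N_G(H):H|<\infty$ for every non-normal subgroup $H$ of $G$. *)

(* Defs.v *)
(* A [groupType] may be infinite; its subgroups are represented by [set G],
   i.e. predicates [G -> Prop]. *)
From mathcomp Require Import all_boot.
From mathcomp Require Import boolp classical_sets cardinality.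

Set Implicit Arguments.
Unset Strict Implicit.
Unset Printing Implicit Defensive.

Local Open Scope classical_set_scope.
Local Open Scope group_scope.

Definition is_subgroup (G : groupType) (H : set G) : Prop :=
  [/\ H 1, forall x y, H x -> H y -> H (x * y) & forall x, H x -> H x^-1].

Definition generated (G : groupType) (A : set G) : set G :=
  smallest (@is_subgroup G) A.

Definition cyclic_subgroup (G : groupType) (x : G) : set G := generated [set x].

Definition conj_set (G : groupType) (H : set G) (g : G) : set G :=
  [set h ^ g | h in H].

Definition is_normal (G : groupType) (H : set G) : Prop :=
  is_subgroup H /\ forall g : G, conj_set H g = H.

Definition normalizer (G : groupType) (H : set G) : set G :=
  [set g | conj_set H g = H].

Definition centralizer (G : groupType) (x : G) : set G :=
  [set g | commute x g].

Definition right_coset (G : groupType) (H : set G) (k : G) : set G :=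
  [set h * k | h in H].

(* |K : H| < oo; intended for subgroups H `<=` K. *)
Definition finite_index (G : groupType) (K H : set G) : Prop :=
  finite_set [set right_coset H k | k in K].

Definition commutator_subgroup (G : groupType) (A B : set G) : set G :=
  generated [set [~ a, b] | a in A & b in B].

(* Numbered from 0: [lower_central H n] is the term usually written
   gamma_(n+1)(H). *)
Fixpoint lower_central (G : groupType) (H : set G) (n : nat) : set G :=
  if n is m.+1 then commutator_subgroup (lower_central H m) H else H.

Definition is_nilpotent (G : groupType) (H : set G) : Prop :=
  exists n : nat, lower_central H n = [set 1].

Definition non_periodic (G : groupType) : Prop :=
  exists x : G, forall n : nat, (0 < n)%N -> x ^+ n <> 1.

Definition locally_nilpotent (G : groupType) : Prop :=
  forall A : set G, finite_set A -> is_nilpotent (generated A).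

Definition FCI_group (G : groupType) : Prop :=
  forall x : G, ~ is_normal (cyclic_subgroup x) ->
    finite_index (centralizer x) (cyclic_subgroup x).

Definition FNI_group (G : groupType) : Prop :=
  forall H : set G, is_subgroup H -> ~ is_normal H ->
    finite_index (normalizer H) H.

(* Main.v *)
Require Import Defs.
From mathcomp Require Import all_boot.
From mathcomp Require Import boolp classical_sets cardinality.

(** An FNI-group satisfies the condition on the normalizers of cyclic subgroups,
    and this condition implies FCI because [C_G(x) <= N_G(<x>)]. The content is that a non-periodic locally nilpotent FCI-group [G] is an FNI-group.

    If [<x>] is not normal, the FCI condition provides [m > 0] such that the
    [m]-th powers of the elements of [C_G(x)] lie in [<x>]. This is combined
    with the fact that in a nilpotent group [K] an exponent of the center
    yields an exponent of [K] ([nilpotent_exponent]).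
    - If [a] has finite order, then [<a>] is normal ([torsion_normal]):
      otherwise the center of [<a, y>], where [y] has infinite order, would
      have finite exponent. Hence the elements of finite order form a subgroup
      [T], on which [G] acts by power automorphisms. Two such automorphisms
      commute, so every commutator centralizes [T].
    - If [<x>] is not normal, then [x] has infinite order, and for every [g]
      some positive power of [x] is central in [<x, g>]. Hence [[~ g, x]] lies
      in [T] ([root_central_mod], [commutator_torsion]). Moreover [C_T(x)] is
      finite, since it embeds in [C_G(x) / <x>].

    Let [H] be a non-normal subgroup. It contains some [x] with [<x>] not
    normal. Put [S = H :&: T], a normal subgroup of [G], and
    [phi g = [~ g, x]]. The map [phi] sends [N_G(H)] into [S], and
    [phi (g * s) = phi g * phi s] for [s] in [S], as [phi g] centralizes [T].
    On each finite normal subgroup [F <= S] the fibers of [phi] have at most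
    [c = #|C_T(x)|] elements, so at most [c] translates of [phi(F)] by elements
    of [F] are pairwise disjoint ([size_transversal_le]). As [T] is locally
    finite, the values of [phi] on [N_G(H)] fall into finitely many classes
    modulo [phi(S)]. If [phi g] and [phi h] are in the same class, then [g]
    lies in [C_G(x) * h * S]. Since [C_G(x)] is covered by finitely many cosets
    [<x> * l] and [S] is normal, such a [g] lies in one of finitely many cosets
    [H * (l * h)]. *)

Set Implicit Arguments.
Unset Strict Implicit.
Unset Printing Implicit Defensive.

Local Open Scope classical_set_scope.
Local Open Scope group_scope.

(** * Subgroups, cyclic subgroups and finite index *)

Section Subgroups.
Variable G : groupType.
Implicit Types (x y g h a b : G) (H K N : set G).

Lemma subgroup1 H : is_subgroup H -> H 1. Proof. by case. Qed.

Lemma subgroupM H x y : is_subgroup H -> H x -> H y -> H (x * y).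
Proof. by case=> _ HM _; apply: HM. Qed.

Lemma subgroupV H x : is_subgroup H -> H x -> H x^-1.
Proof. by case=> _ _ HV; apply: HV. Qed.

Lemma subgroupX H x n : is_subgroup H -> H x -> H (x ^+ n).
Proof.
move=> sH Hx; elim: n => [|n IHn]; first by rewrite expg0; apply: subgroup1.
by rewrite expgS; apply: subgroupM.
Qed.

Lemma subgroupJ H x y : is_subgroup H -> H x -> H y -> H (x ^ y).
Proof.
by move=> sH Hx Hy; rewrite conjgE; do ?apply: subgroupM => //; apply: subgroupV.
Qed.

Lemma subgroupR H x y : is_subgroup H -> H x -> H y -> H [~ x, y].
Proof.
move=> sH Hx Hy; rewrite commgEl; apply: subgroupM => //; first exact: subgroupV.
exact: subgroupJ.
Qed.

Lemma generated_subgroup (A : set G) : is_subgroup (generated A).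
Proof.
split=> [B [sB _]|x y Ax Ay B [sB AB]|x Ax B [sB AB]].
- exact: subgroup1.
- by apply: subgroupM => //; [apply: Ax | apply: Ay].
- by apply: subgroupV => //; apply: Ax.
Qed.

Lemma sub_generated (A : set G) x : A x -> generated A x.
Proof. by move=> Ax B [_]; apply. Qed.

Lemma generated_min (A H : set G) x :
  is_subgroup H -> A `<=` H -> generated A x -> H x.
Proof. by move=> sH AH; apply. Qed.

Lemma cyclic_subgroup_subgroup x : is_subgroup (cyclic_subgroup x).
Proof. exact: generated_subgroup. Qed.

Lemma cyclic_id x : cyclic_subgroup x x.
Proof. exact: sub_generated. Qed.

Lemma cyclic_min H x y : is_subgroup H -> H x -> cyclic_subgroup x y -> H y.
Proof. by move=> sH Hx; apply: generated_min => // _ ->. Qed.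

Lemma commuteX_self x m n : commute (x ^+ m) (x ^+ n).
Proof. by apply: commuteX2; apply: commute_refl. Qed.

Lemma cyclicP x y :
  cyclic_subgroup x y <-> exists n, y = x ^+ n \/ y = x ^- n.
Proof.
have sC := cyclic_subgroup_subgroup x; split=> [|[n yE]]; last first.
  have Cn : cyclic_subgroup x (x ^+ n) by apply: (subgroupX n sC); apply: (@cyclic_id x).
  by case: yE => ->; [exact: Cn | exact: (subgroupV sC Cn)].
apply: (@cyclic_min [set y | exists n, y = x ^+ n \/ y = x ^- n]);
  last by exists 1%N; left.
have expB m n : exists k, x ^+ m / x ^+ n = x ^+ k \/ x ^+ m / x ^+ n = x ^- k.
  case: (leqP n m) => [lenm|/ltnW lemn]; first by exists (m - n)%N; left; rewrite expgnFr.
  by exists (n - m)%N; right; rewrite expgnFr // invgF.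
split=> [|y1 y2 [m [] ->] [n [] ->]|y1 [n [] ->]].
- by exists 0%N; left.
- by exists (m + n)%N; left; rewrite expgnDr.
- exact: expB.
- have -> : x ^- m * x ^+ n = x ^+ n / x ^+ m.
    by apply/esym/commuteV/commuteX_self.
  exact: expB.
- by exists (n + m)%N; right; rewrite expgnDr invgM.
- by exists n; right.
- by exists n; left; rewrite invgK.
Qed.

Lemma is_normalI H :
  is_subgroup H -> (forall h g, H h -> H (h ^ g)) -> is_normal H.
Proof.
move=> sH nH; split=> // g; apply/seteqP; split=> [_ [h Hh <-]|h Hh].
  exact: nH.
by exists (h ^ g^-1); [apply: nH | rewrite conjgKV].
Qed.

Lemma normalJ H h g : is_normal H -> H h -> H (h ^ g).
Proof. by case=> _ /(_ g) {2}<- Hh; exists h. Qed.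

Lemma normalizerJ H h g : normalizer H g -> H h -> H (h ^ g).
Proof. by move=> {2}<- Hh; exists h. Qed.

Lemma centralizer_subgroup x : is_subgroup (centralizer x).
Proof.
split; [exact: commute1 | by move=> g h; apply: commuteM | exact: commuteV].
Qed.

Lemma centralizer_normalizer x : centralizer x `<=` normalizer (cyclic_subgroup x).
Proof.
move=> g cxg; have fixg h : cyclic_subgroup x h -> h ^ g = h.
  move=> Hh; apply/conjg_fixP/commgP; apply: commute_sym.
  apply: (cyclic_min (centralizer_subgroup g)) Hh.
  exact: commute_sym.
apply/seteqP; split=> [_ [h Hh <-]|h Hh]; first by rewrite fixg.
by exists h => //; apply: fixg.
Qed.

(** Finite index means that finitely many right cosets of [H] cover [K]; their
    representatives need not lie in [K]. *)
Lemma finite_indexP K H : is_subgroup H ->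
  finite_index K H <->
  exists L : seq G, forall k, K k -> exists2 l, l \in L & H (k * l^-1).
Proof.
move=> sH; split=> [|[L KL]].
  move=> /finite_seqP[s Es].
  exists [seq xget 1 [set k | right_coset H k = C] | C <- s] => k Kk.
  have sk : right_coset H k \in s.
    have : [set right_coset H k | k in K] (right_coset H k) by exists k.
    by rewrite Es.
  exists (xget 1 [set j | right_coset H j = right_coset H k]).
    by apply/mapP; exists (right_coset H k).
  case: xgetP => [l _ /= El|/(_ k)/= []//].
  have : right_coset H k k by exists 1; [apply: subgroup1 | rewrite mul1g].
  by rewrite -El => -[h Hh <-]; rewrite mulgK.
apply: (@sub_finite_set _ _ [set right_coset H l | l in [set` L]]); last first.
  by apply: finite_image; apply: finite_seq.
move=> _ [k Kk <-]; have [l Ll Hkl] := KL k Kk; exists l => //=.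
apply/seteqP; split=> _ [h Hh <-].
  exists (h * (k * l^-1)^-1); last by rewrite !gnorm.
  by apply: subgroupM => //; apply: subgroupV.
exists (h * (k * l^-1)); last by rewrite !gnorm.
exact: subgroupM.
Qed.

Lemma finite_index_sub K K' H :
  K' `<=` K -> finite_index K H -> finite_index K' H.
Proof. by move=> sK; apply: sub_finite_set; apply: image_subset. Qed.

(** Two of the powers [z ^+ 0, ..., z ^+ n] fall in the same coset of [H] when
    [n] cosets cover [K], so that [n`!] is a suitable exponent. *)
Lemma finite_index_exponent K H : is_subgroup K -> is_subgroup H ->
  finite_index K H -> exists2 m, (0 < m)%N & forall z, K z -> H (z ^+ m).
Proof.
move=> sK sH /(finite_indexP _ sH)[L KL].
exists (size L)`!; first exact: fact_gt0.
move=> z Kz.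
have [f fP] : {f : nat -> G & forall i, f i \in L /\ H (z ^+ i * (f i)^-1)}.
  apply: (@boolp.choice _ _ (fun i l => l \in L /\ H (z ^+ i * l^-1))) => i.
  have [l Ll Hl] := KL (z ^+ i) (subgroupX i sK Kz).
  by exists l.
have : ~~ uniq [seq f i | i <- iota 0 (size L).+1].
  apply/negP => /uniq_leq_size-/(_ L); rewrite size_map size_iota ltnn.
  by move=> LL; suff: false by []; apply: LL => _ /mapP[i _ ->]; case: (fP i).
case/(uniqPn 1) => i [j [ltij]]; rewrite size_map size_iota => ltj.
have lti := ltn_trans ltij ltj.
rewrite !(nth_map 0%N) ?size_iota // !nth_iota // !add0n => Eij.
have Hji : H (z ^+ (j - i)).
  rewrite expgnFr 1?ltnW // -(mulgKA (f j)^-1) -{2}Eij.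
  by apply: subgroupM (fP j).2 _ => //; apply: subgroupV (fP i).2.
have /dvdnP[q ->] : (j - i)%N %| (size L)`!.
  by apply: dvdn_fact; rewrite subn_gt0 ltij /= (leq_trans (leq_subr _ _)).
by rewrite mulnC expgnA; apply: subgroupX.
Qed.

(** Modulo [N], the elements [u] and [w] commute, so the power of their product
    is the product of their powers. *)
Lemma expgM_modN N K : is_subgroup N -> is_subgroup K ->
  (forall n k, N n -> K k -> N (n ^ k)) ->
  forall u w n, K u -> K w -> N [~ w, u] ->
  exists2 t, N t & (u * w) ^+ n = u ^+ n * w ^+ n * t.
Proof.
move=> sN sK nN u w n Ku Kw Nwu.
have wun j : exists2 t, N t & w ^+ j * u = u * w ^+ j * t.
  elim: j => [|j [t Nt IHj]].
    by exists 1; [apply: subgroup1 | rewrite !expg0 !gsimp].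
  exists ([~ w, u] ^ (w ^+ j) * t).
    apply: subgroupM => //; apply: nN => //; exact: subgroupX.
  by rewrite expgS -mulgA IHj /commg !conjgE !gnorm.
elim: n => [|n [t Nt IHn]].
  by exists 1; [apply: subgroup1 | rewrite !expg0 !gsimp].
have [r Nr Er] := wun n.
exists ((r ^ w) * (t ^ (u * w))).
  apply: subgroupM => //; apply: nN => //; exact: subgroupM.
rewrite !expgSr IHn.
have -> : u ^+ n * w ^+ n * t * (u * w) = u ^+ n * (w ^+ n * u) * w * t ^ (u * w).
  by rewrite conjgE !mulgA !gnorm.
by rewrite Er !conjgE !gnorm.
Qed.
End Subgroups.

(** * The upper central series of a nilpotent subgroup *)

Section UpperCentral.
Variables (G : groupType) (K : set G).
Hypothesis sK : is_subgroup K.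
Implicit Types (g h u v x : G).

(** The upper central series of the subgroup [K], starting at [[set 1]]; its
    terms are subsets of the ambient group contained in [K]. *)
Fixpoint upper_central i : set G :=
  if i is j.+1 then [set g | K g /\ forall h, K h -> upper_central j [~ g, h]]
  else [set 1].

Lemma upper_central_sub i g : upper_central i g -> K g.
Proof. by case: i => [->|i []//]; apply: subgroup1. Qed.

Lemma upper_centralJ i g h : K h -> upper_central i g -> upper_central i (g ^ h).
Proof.
elim: i g h => [|i IHi] g h Kh; first by move=> ->; rewrite conj1g.
case=> Kg Zg; split=> [|k Kk]; first exact: subgroupJ.
rewrite -[k](conjgKV h) -conjRg; apply: IHi => //; apply: Zg.
by apply: subgroupJ => //; apply: subgroupV.
Qed.

Lemma upper_central_subgroup i : is_subgroup (upper_central i).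
Proof.
elim: i => [|i IHi].
  by split=> [//|_ _ -> ->|_ ->]; rewrite /= gsimp.
split=> [|x y [Kx Zx] [Ky Zy]|x [Kx Zx]].
- by split=> [|h Kh]; [apply: subgroup1 | rewrite comm1g; apply: subgroup1].
- split=> [|h Kh]; first exact: subgroupM.
  have -> : [~ x * y, h] = [~ x, h] ^ y * [~ y, h].
    by rewrite /commg !conjgE !gnorm.
  by apply: subgroupM IHi _ (Zy h Kh); apply: upper_centralJ (Zx h Kh).
- split=> [|h Kh]; first exact: subgroupV.
  have -> : [~ x^-1, h] = [~ x, h]^-1 ^ x^-1.
    by rewrite /commg !conjgE !gnorm.
  apply: upper_centralJ; first exact: subgroupV.
  by apply: subgroupV IHi (Zx h Kh).
Qed.

(** The definition of nilpotency refers to the lower central series; if it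
    reaches [1] in [n] steps, its term of index [n - i] lies in the [i]-th term
    of the upper central series. *)
Lemma is_nilpotent_upper_central :
  is_nilpotent K -> exists n, forall g, K g -> upper_central n g.
Proof.
move=> [n LCn]; exists n.
have LCK m : lower_central K m `<=` K.
  elim: m => [//|m IHm] g; apply: generated_min => // _ [a Aa [b Kb <-]].
  by apply: subgroupR => //; apply: IHm.
suff H i : (i <= n)%N -> lower_central K (n - i) `<=` upper_central i.
  by have := H n (leqnn n); rewrite subnn.
elim: i => [_|i IHi ltin]; first by rewrite subn0 LCn.
move=> g LCg; split=> [|h Kh]; first exact: LCK LCg.
apply: (IHi (ltnW ltin)); rewrite -(subnSK ltin); apply: sub_generated.
by exists g => //; exists h.
Qed.

(** In a nilpotent group, an exponent of the center gives an exponent of the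
    group: each factor of the upper central series has the exponent of the
    first one. *)
Lemma nilpotent_exponent e : is_nilpotent K ->
  (forall z, K z -> (forall h, K h -> commute z h) -> z ^+ e = 1) ->
  exists c, forall g, K g -> g ^+ (e ^ c) = 1.
Proof.
move=> nilK eZ.
have Ze i g : upper_central i.+1 g -> upper_central i (g ^+ e).
  elim: i g => [|i IHi] g [Kg Zg].
    by apply: eZ => // h Kh; apply/commgP/eqP; apply: Zg.
  split=> [|h Kh]; first exact: subgroupX.
  have Zw : upper_central i.+1 [~ g, h] := Zg h Kh.
  have Kw := upper_central_sub Zw.
  have [t Zt Et] := expgM_modN (upper_central_subgroup i) sK
    (fun n k Zn Kk => upper_centralJ Kk Zn) e Kg Kw (Zw.2 g Kg).
  (* [[~ g, h]] commutes with [g] modulo the [i]-th term. *)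
  have -> : [~ g ^+ e, h] = [~ g, h] ^+ e * t.
    have Egh : g ^ h = g * [~ g, h] by rewrite commgEl mulVKg.
    by rewrite commgEl conjXg Egh Et !gnorm.
  by apply: (subgroupM (upper_central_subgroup i)) Zt; apply: IHi.
have [c Zc] := is_nilpotent_upper_central nilK; exists c => g /Zc.
elim: c g {Zc} => [g ->|c IHc g /Ze/IHc]; first by rewrite expg1n.
by rewrite expnS expgnA.
Qed.

(** Let [N] be a subgroup normalized by [K] and closed under taking roots in [K].
    An element of a nilpotent group [K] with a positive power in the center is
    central modulo [N]. *)
Lemma root_central_mod (N : set G) u n : is_subgroup N ->
  (forall t k, N t -> K k -> N (t ^ k)) ->
  (forall t m, K t -> (0 < m)%N -> N (t ^+ m) -> N t) ->
  is_nilpotent K -> K u -> (0 < n)%N ->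
  (forall h, K h -> commute (u ^+ n) h) ->
  forall v, K v -> N [~ u, v].
Proof.
move=> sN nN rN nilK Ku n_gt0 Zun v.
have [c Zc] := is_nilpotent_upper_central nilK => /Zc.
elim: c v {Zc} => [v ->|c IHc v [Kv Zv]].
  by rewrite commg1; apply: subgroup1.
(* By induction [[~ u, v]] commutes with [u] modulo [N], so that its [n]-th power
   lies in [N] because [u ^+ n] commutes with [v]. *)
have Kw : K [~ u, v] by apply: subgroupR.
have Nwu : N [~ [~ u, v], u].
  rewrite -invgR; apply: subgroupV => //; apply: IHc.
  rewrite -invgR; apply: (subgroupV (upper_central_subgroup c)); exact: Zv.
have [t Nt Et] := expgM_modN sN sK nN n Ku Kw Nwu.
apply: (rN _ n) => //.
have : (u ^+ n) ^ v = u ^+ n by apply/conjg_fixP/commgP/Zun.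
have Euv : u ^ v = u * [~ u, v] by rewrite commgEl mulVKg.
rewrite conjXg Euv Et -mulgA -[RHS]mulg1 => /mulgI /(canRL (mulgK t)).
by rewrite mul1g => ->; apply: subgroupV.
Qed.
End UpperCentral.

(** * Counting *)

Section Counting.
Variable G : groupType.

(** Choosing unrelated elements greedily produces arbitrarily many of them,
    unless finitely many elements are related to all the others. *)
Lemma pairwise_or_cover (D : set G) (R : G -> G -> Prop) (n : nat) :
  (forall u, R u u) -> (forall u v, R u v -> R v u) ->
  (exists us : seq G, [/\ size us = n, uniq us, forall u, u \in us -> D u &
     forall u v, u \in us -> v \in us -> R u v -> u = v]) \/
  exists L : seq G, forall g, D g -> exists2 h, h \in L & R h g.
Proof.
move=> Rxx Rsym; elim: n => [|n [[us [<- Uus Dus Rus]]|]]; last by right.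
  by left; exists [::].
case: (pselect (exists2 g, D g & forall h, h \in us -> ~ R h g)) => [[g Dg NR]|].
  left; exists (g :: us); split=> //=.
  - by rewrite Uus andbT; apply/negP => /NR.
  - by move=> u; rewrite in_cons => /predU1P[->|/Dus].
  move=> u v; rewrite !in_cons => /predU1P[->|us_u] /predU1P[->|us_v] //.
  - by move=> /Rsym /NR; case.
  - by move=> /NR; case.
  - exact: Rus.
move=> NE; right; exists us => g Dg; apply: contrapT => NR; apply: NE.
by exists g => // h us_h Rhg; apply: NR; exists h.
Qed.

(** The sets [u * f(F)] with [u] in [us] are pairwise disjoint subsets of [F], so
    [size us * #|f(F)| <= #|F|]; the fibers of [f] on [F] lie in translates of [C],
    so [#|F| <= size C * #|f(F)|]. *)
Lemma size_transversal_le (F : set G) (f : G -> G) (C us : seq G) :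
  finite_set F -> is_subgroup F -> (forall s, F s -> F (f s)) ->
  (forall s t, F s -> F t -> f s = f t -> s * t^-1 \in C) ->
  uniq us -> (forall u, u \in us -> F u) ->
  (forall u v s t, u \in us -> v \in us -> F s -> F t ->
     u * f s = v * f t -> u = v) ->
  (size us <= size C)%N.
Proof.
move=> /finite_seqP[Fs0 FE] sF fF fC Uus Fus us_inj.
have {FE} Fmem s : F s <-> s \in undup Fs0 by rewrite mem_undup FE.
have Us : uniq (undup Fs0) by apply: undup_uniq.
move: (undup Fs0) Us Fmem => Fs UFs Fmem.
pose E := undup [seq f s | s <- Fs].
have Emem e : e \in E -> exists2 s, F s & e = f s.
  by rewrite mem_undup => /mapP[s /Fmem]; exists s.
have le1 : (size us * size E <= size Fs)%N.
  rewrite -(size_allpairs (fun u e => u * e)); apply: uniq_leq_size.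
    apply: allpairs_uniq => //; first exact: undup_uniq.
    move=> [u e] [v e'] /allpairsP[[u1 e1] /= [us_u Ee [-> ->]]].
    move=> /allpairsP[[v1 e2] /= [us_v Ee' [-> ->]]] /= Eq.
    have [s Fs_s Es] := Emem _ Ee; have [t Fs_t Et] := Emem _ Ee'.
    have uv : u1 = v1 by apply: (us_inj _ _ s t) => //; rewrite -Es -Et.
    by congr pair => //; apply: (mulgI v1); rewrite -Eq uv.
  move=> _ /allpairsP[[u e] /= [us_u /Emem[s Fs_s ->] ->]]; apply/Fmem.
  by apply: subgroupM => //; [apply: Fus | apply: fF].
(* [r e] is a preimage of [e] under [f], for [e] in [f(F)]. *)
pose r e := nth 1 Fs (index e [seq f s | s <- Fs]).
have rP s : s \in Fs -> r (f s) \in Fs /\ f (r (f s)) = f s.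
  move=> Fs_s; have lti : (index (f s) [seq f s | s <- Fs] < size Fs)%N.
    by rewrite -(size_map f) index_mem map_f.
  split; first exact: mem_nth.
  by rewrite -(nth_map 1 (f 1)) // nth_index // map_f.
have le2 : (size Fs <= size C * size E)%N.
  rewrite -(size_allpairs (fun c e => c * r e)); apply: uniq_leq_size => // s Fs_s.
  have [Fs_r fr] := rP s Fs_s; apply/allpairsP; exists (s / r (f s), f s) => /=.
  split; [by apply: fC => //; apply/Fmem | by rewrite mem_undup map_f |].
  by rewrite mulgVK.
have E_gt0 : (0 < size E)%N.
  have : f 1 \in E by rewrite mem_undup map_f //; apply/Fmem; apply: subgroup1.
  by rewrite lt0n size_eq0; apply: contraTneq => ->.
by rewrite -(leq_pmul2r E_gt0) (leq_trans le1 le2).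
Qed.
End Counting.

(** * Elements of finite order in an FCI-group *)

Section FCI.
Variable G : groupType.
Implicit Types (a g h t u x y z : G).

(** The set of elements of finite order; that it is a subgroup is proved below
    under the FCI condition. *)
Definition torsion : set G := [set a | exists2 n, (0 < n)%N & a ^+ n = 1].

Lemma torsion_cyclic a b : torsion a -> cyclic_subgroup a b ->
  exists n, b = a ^+ n.
Proof.
move=> [n n_gt0 an1] /cyclicP[k [->|->]]; first by exists k.
(* [k * n - k] is a natural number congruent to [- k] modulo [n]. *)
exists (k * n - k)%N; rewrite expgnFr; last by rewrite leq_pmulr.
by rewrite mulnC expgnA an1 expg1n mul1g.
Qed.

Lemma torsionJ a g : torsion a -> torsion (a ^ g).
Proof. by move=> [n n_gt0 an1]; exists n => //; rewrite -conjXg an1 conj1g. Qed.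

Lemma torsionX a n : (0 < n)%N -> torsion (a ^+ n) -> torsion a.
Proof.
move=> n_gt0 [m m_gt0 anm]; exists (n * m)%N; first by rewrite muln_gt0 n_gt0.
by rewrite expgnA.
Qed.

Hypothesis npG : non_periodic G.
Hypothesis lnG : locally_nilpotent G.
Hypothesis fciG : FCI_group G.

Lemma centralizer_exponent x : ~ is_normal (cyclic_subgroup x) ->
  exists2 m, (0 < m)%N & forall z, commute x z -> cyclic_subgroup x (z ^+ m).
Proof.
move=> /fciG; apply: finite_index_exponent; first exact: centralizer_subgroup.
exact: cyclic_subgroup_subgroup.
Qed.

Lemma gen2_nilpotent x y : is_nilpotent (generated [set x; y]).
Proof. exact/lnG/finite_set2. Qed.

Lemma torsion_normal a : torsion a -> is_normal (cyclic_subgroup a).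
Proof.
move=> Ta; apply: contrapT => /centralizer_exponent[m m_gt0 Cm].
have [y y_inf] := npG; have [n n_gt0 an1] := Ta.
pose K := generated [set a; y].
have Ka : K a by apply: sub_generated; left.
have Ky : K y by apply: sub_generated; right.
have [|c Kc] := @nilpotent_exponent G K (generated_subgroup _) (m * n)
  (gen2_nilpotent a y).
  move=> z Kz Zz; have cza := Zz a Ka.
  have [k zk] := torsion_cyclic Ta (Cm z (commute_sym cza)).
  by rewrite expgnA zk -expgnA mulnC expgnA an1 expg1n.
by apply: y_inf (Kc y Ky); rewrite expn_gt0 muln_gt0 m_gt0 n_gt0.
Qed.

Lemma torsion_power_aut a g : torsion a -> exists n, a ^ g = a ^+ n.
Proof.
move=> Ta; apply: torsion_cyclic => //; apply: normalJ (torsion_normal Ta) _.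
exact: cyclic_id.
Qed.

Lemma torsion_subgroup : is_subgroup torsion.
Proof.
split=> [|a b Ta [n n_gt0 bn1]|a [n n_gt0 an1]].
- by exists 1%N => //; rewrite expg1n.
- have [k Ek] := torsion_power_aut b Ta.
  have [m Em] : exists m, (a * b) ^+ n = b ^+ n * a ^+ m.
    elim: {bn1 n_gt0} n => [|n [m IHn]]; first by exists 0%N; rewrite !expg0 gsimp.
    exists (k * m.+1)%N; rewrite !expgSr IHn expgnA -Ek -conjXg expgSr conjgE.
    by rewrite !gnorm.
  by apply: (torsionX n_gt0); rewrite Em bn1 mul1g; case: Ta => l l_gt0 al1;
    exists l => //; rewrite -expgnA mulnC expgnA al1 expg1n.
- by exists n => //; rewrite expVgn an1 invg1.
Qed.

Lemma commutator_centralizes_torsion a g h : torsion a -> commute a [~ g, h].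
Proof.
move=> Ta; apply/commgP; rewrite -conjg_fix; apply/eqP.
have -> : [~ g, h] = (h * g)^-1 * (g * h) by rewrite /commg conjgE !gnorm.
suff H b : torsion b -> b ^ (g * h) = b ^ (h * g).
  by rewrite conjgM H ?conjgKV //; apply: torsionJ.
move=> Tb; have [i Ei] := torsion_power_aut g Tb.
have [j Ej] := torsion_power_aut h Tb.
by rewrite !conjgM Ei Ej !conjXg Ei Ej -!expgnA mulnC.
Qed.

(** * Commutators with a generator of a non-normal cyclic subgroup *)

Section NonNormal.
Variable x : G.
Hypothesis x_nn : ~ is_normal (cyclic_subgroup x).

Lemma nonnormal_torsion : ~ torsion x.
Proof. by move/torsion_normal. Qed.

Let phi g := [~ g, x].

(** In general [phi (g * s) = phi g ^ s * phi s], and the commutator [phi g]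
    commutes with [s] when [s] has finite order. *)
Lemma commgM_torsion g s : torsion s -> phi (g * s) = phi g * phi s.
Proof.
move=> Ts; have /commgP := commutator_centralizes_torsion g x Ts.
rewrite commg1_sym -conjg_fix => /eqP; rewrite /phi /commg !conjgE !gnorm => E.
by rewrite -[in RHS]E !gnorm.
Qed.

Lemma commg_eqP g h : phi g = phi h -> commute x (g * h^-1).
Proof.
move=> E; apply/commgP/eqP; rewrite -invgR.
have -> : [~ g * h^-1, x] = (phi g * (phi h)^-1) ^ h^-1.
  by rewrite /phi /commg !conjgE !gnorm.
by rewrite E mulgV conj1g invg1.
Qed.

Lemma commutator_torsion g : torsion (phi g).
Proof.
have [m m_gt0 Cm] := centralizer_exponent x_nn.
pose K := generated [set x; g].
have sK : is_subgroup K by apply: generated_subgroup.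
have Kx : K x by apply: sub_generated; left.
have Kg : K g by apply: sub_generated; right.
(* Otherwise [<x>] meets the center of [K] trivially, so that [m] is an
   exponent of this center and [x] has finite order. *)
have [n n_gt0 Zxn] : exists2 n, (0 < n)%N & forall h, K h -> commute (x ^+ n) h.
  apply: contrapT => NZ; apply: nonnormal_torsion.
  have [|c Kc] := @nilpotent_exponent G K sK m (gen2_nilpotent x g).
    move=> z Kz Zz; have /cyclicP[k zk] := Cm z (commute_sym (Zz x Kx)).
    have [k0|k_gt0] := posnP k; first by case: zk => ->; rewrite k0 // invg1.
    case: NZ; exists k => // h Kh; have : commute (z ^+ m) h.
      by apply/commute_sym/commuteX/commute_sym/Zz.
    by case: zk => -> // /commute_sym/commuteV; rewrite invgK => /commute_sym.
  by exists (m ^ c)%N; [rewrite expn_gt0 m_gt0 | apply: Kc].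
have sT := torsion_subgroup.
rewrite /phi -invgR; apply: (subgroupV sT).
apply: (root_central_mod sK sT _ _ (gen2_nilpotent x g) Kx n_gt0 Zxn Kg).
  by move=> t k Tt _; apply: torsionJ.
by move=> t k _; apply: torsionX.
Qed.

(** A coset of [<x>] contains at most one element of finite order that
    centralizes [x]. *)
Lemma centralizer_torsion_finite :
  exists C : seq G, forall t, torsion t -> commute x t -> t \in C.
Proof.
have sX := cyclic_subgroup_subgroup x.
have [L CL] := (finite_indexP _ sX).1 (fciG x_nn).
pose P l t := [/\ torsion t, commute x t & cyclic_subgroup x (t * l^-1)].
exists [seq xget 1 [set t | P l t] | l <- L] => t Tt xt.
have [l Ll Xtl] := CL t xt; apply/mapP; exists l => //.
case: xgetP => [s _ [Ts xs Xsl]|/(_ t)/= []//].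
have sT := torsion_subgroup.
have : cyclic_subgroup x (t * s^-1).
  rewrite -(mulgKA l^-1); apply: (subgroupM sX Xtl); exact: (subgroupV sX Xsl).
have Tts : torsion (t * s^-1) by apply: subgroupM => //; apply: subgroupV.
move=> /cyclicP[k Ek]; have [k0|k_gt0] := posnP k.
  by apply/divg1_eq; case: Ek => ->; rewrite k0 // invg1.
case: nonnormal_torsion; apply: (torsionX k_gt0).
case: Ek Tts => -> // /(subgroupV sT); by rewrite invgK.
Qed.
End NonNormal.

(** * Normalizers of non-normal subgroups *)

Lemma cyclic_torsion_finite a : torsion a -> finite_set (cyclic_subgroup a).
Proof.
move=> Ta; have [n n_gt0 an1] := Ta.
apply: (@sub_finite_set _ _ [set` [seq a ^+ i | i <- iota 0 n]]); last exact: finite_seq.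
move=> _ /(torsion_cyclic Ta)[k ->] /=; apply/mapP; exists (k %% n)%N.
  by rewrite mem_iota add0n ltn_mod.
by rewrite {1}(divn_eq k n) expgnDr mulnC expgnA an1 expg1n mul1g.
Qed.

(** Finitely many elements of a subgroup [S] of elements of finite order lie in
    the product of the normal finite cyclic groups that they generate. *)
Lemma torsion_finite_normal_sub (S : set G) (us : seq G) :
  is_subgroup S -> S `<=` torsion -> (forall u, u \in us -> S u) ->
  exists F, [/\ finite_set F, is_normal F, F `<=` S &
                forall u, u \in us -> F u].
Proof.
move=> sS ST; elim: us => [_|a us IHus Sus].
  exists [set 1]; split=> //.
    apply: is_normalI; last by move=> h g ->; rewrite conj1g.
    by split=> [//|_ _ -> ->|_ ->]; rewrite /= gsimp.
  by move=> _ ->; apply: subgroup1.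
have [u us_u|F [finF nF FS Fus]] := IHus; first by apply: Sus; rewrite in_cons us_u orbT.
have Sa : S a by apply: Sus; rewrite mem_head.
have Ta := ST a Sa; have nA := torsion_normal Ta.
have sA := nA.1; have sF := nF.1.
exists [set b * f | b in cyclic_subgroup a & f in F]; split.
- by apply: finite_image2 => //; apply: cyclic_torsion_finite.
- apply: is_normalI; last first.
    move=> _ g [b Ab [f Ff <-]]; exists (b ^ g); first exact: (normalJ g nA Ab).
    by exists (f ^ g); [apply: normalJ | rewrite conjMg].
  split.
  + by exists 1; [apply: (subgroup1 sA) | exists 1; [apply: subgroup1 | rewrite gsimp]].
  + move=> _ _ [b Ab [f Ff <-]] [c Ac [h Fh <-]].
    exists (b * c ^ f^-1); first exact: (subgroupM sA Ab (normalJ f^-1 nA Ac)).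
    by exists (f * h); [apply: subgroupM | rewrite conjgE !gnorm].
  + move=> _ [b Ab [f Ff <-]].
    exists (b^-1 ^ f); first exact: (normalJ f nA (subgroupV sA Ab)).
    by exists f^-1; [apply: subgroupV | rewrite conjgE !gnorm].
- move=> _ [b Ab [f Ff <-]]; apply: (subgroupM sS); last exact: FS.
  exact: cyclic_min Ab.
- move=> u; rewrite in_cons => /predU1P[->|/Fus Fu].
    by exists a; [exact: (@cyclic_id _ a) | exists 1; [apply: subgroup1 | rewrite mulg1]].
  by exists 1; [apply: (subgroup1 sA) | exists u => //; rewrite mul1g].
Qed.

Lemma normalizer_finite_index x H : ~ is_normal (cyclic_subgroup x) ->
  is_subgroup H -> H x -> finite_index (normalizer H) H.
Proof.
move=> x_nn sH Hx; pose S : set G := [set t | H t /\ torsion t].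
have sT := torsion_subgroup.
have sS : is_subgroup S.
  split=> [|a b [Ha Ta] [Hb Tb]|a [Ha Ta]].
  - by split; apply: subgroup1.
  - by split; apply: subgroupM.
  - by split; apply: subgroupV.
have ST : S `<=` torsion by move=> t [].
have nS t g : S t -> S (t ^ g).
  move=> [Ht Tt]; split; last exact: torsionJ.
  by have [n ->] := torsion_power_aut g Tt; apply: subgroupX.
have S_phi g : normalizer H g -> S [~ g, x].
  move=> Ng; split; last exact: commutator_torsion.
  rewrite -invgR; apply: subgroupV => //; rewrite commgEl.
  apply: subgroupM => //; first exact: subgroupV.
  exact: normalizerJ.
have phiM g s : S s -> [~ g * s, x] = [~ g, x] * [~ s, x].
  by move=> /ST; apply: commgM_torsion.
have [C CP] := centralizer_torsion_finite x_nn.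
(* [R g h] holds when [[~ g, x]] and [[~ h, x]] are congruent modulo the image
   of [S] under [[~ _, x]]. *)
pose R g h := exists s t, [/\ S s, S t & [~ g, x] * [~ s, x] = [~ h, x] * [~ t, x]].
have Rxx u : R u u by exists 1, 1; split=> //; apply: subgroup1.
have Rsym u v : R u v -> R v u by move=> [s [t [Ss St E]]]; exists t, s.
have [[us [szus Uus Nus Rus]]|[Lh NLh]] :=
  pairwise_or_cover (normalizer H) (size C).+1 Rxx Rsym.
  (* Too many classes contradict the count in a finite normal subgroup [F]. *)
  pose ws := [seq [~ u, x] | u <- us].
  have Sws w : w \in ws -> S w by move=> /mapP[u /Nus Nu ->]; apply: S_phi.
  have [F [finF nF FS Fws]] := torsion_finite_normal_sub sS ST Sws.
  suff : (size ws <= size C)%N by rewrite size_map szus ltnn.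
  apply: (@size_transversal_le G F (fun s => [~ s, x])) => //.
  - exact: nF.1.
  - move=> s Fs; apply: subgroupM; first exact: nF.1.
      by apply: subgroupV Fs; exact: nF.1.
    exact: normalJ.
  - move=> s t Fs Ft /commg_eqP; apply: CP.
    by apply: subgroupM => //; [|apply: subgroupV => //]; apply: ST; apply: FS.
  - rewrite map_inj_in_uniq // => u v us_u us_v Euv; apply: Rus => //.
    by exists 1, 1; split; [exact: subgroup1..|rewrite Euv].
  - move=> _ _ s t /mapP[u us_u ->] /mapP[v us_v ->] Fs Ft E.
    congr [~ _, x]; apply: Rus => //; exists s, t.
    by split=> //; apply: FS.
have sX := cyclic_subgroup_subgroup x.
have [L CL] := (finite_indexP _ sX).1 (fciG x_nn).
apply/(finite_indexP _ sH); exists [seq l * h | l <- L, h <- Lh] => g Ng.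
have [h Lh_h [s [t [Ss St]]]] := NLh g Ng.
rewrite -!phiM // => /esym/commg_eqP/CL[l Ll Xl].
exists (l * h); first by apply/allpairsP; exists (l, h).
have -> : g * (l * h)^-1 =
    (g * t * (h * s)^-1 * l^-1) * (s * t^-1) ^ (l * h)^-1.
  by rewrite conjgE !gnorm.
apply: (subgroupM sH); first exact: cyclic_min Xl.
apply: (nS _ _ _).1; apply: subgroupM => //; exact: subgroupV.
Qed.
Lemma FCI_FNI : FNI_group G.
Proof.
move=> H sH nnH.
have [x Hx x_nn] : exists2 x, H x & ~ is_normal (cyclic_subgroup x).
  apply: contrapT => allN; apply: nnH; apply: is_normalI => // h g Hh.
  apply: (@cyclic_min _ H h) => //.
  apply: (@normalJ _ _ h g) (@cyclic_id _ h).
  by apply: contrapT => nn; apply: allN; exists h.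
exact: normalizer_finite_index x_nn sH Hx.
Qed.
End FCI.

Theorem theorem3p4 (G : groupType) :
  non_periodic G -> locally_nilpotent G ->
  (FNI_group G <-> FCI_group G) /\
  (FCI_group G <->
   (forall x : G, ~ is_normal (cyclic_subgroup x) ->
      finite_index (normalizer (cyclic_subgroup x)) (cyclic_subgroup x))).
Proof.
move=> npG lnG.
have FNI_cyclic : FNI_group G -> forall x : G, ~ is_normal (cyclic_subgroup x) ->
    finite_index (normalizer (cyclic_subgroup x)) (cyclic_subgroup x).
  by move=> fniG x; apply: fniG; apply: cyclic_subgroup_subgroup.
have cyclic_FCI : (forall x : G, ~ is_normal (cyclic_subgroup x) ->
    finite_index (normalizer (cyclic_subgroup x)) (cyclic_subgroup x)) ->
    FCI_group G.
  by move=> nG x /nG; apply: finite_index_sub; apply: centralizer_normalizer.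
have fci_fni := FCI_FNI npG lnG.
split; split=> [fniG|fciG].
- exact/cyclic_FCI/FNI_cyclic.
- exact: fci_fni.
- exact/FNI_cyclic/fci_fni.
- exact: cyclic_FCI.
Qed.
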